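(* Let $R$ be an integral domain, let $M$ be a free $R$-module of finite rank with an antisymmetric bilinear form $\langle\cdot,\cdot\rangle : M\times M\to R$ such that $\langle x,x\rangle=0$ for all $x\in M$, and let $(M,* )$ be the associated symplectic quandle, $x*y = x+\langle x,y\rangle y$. Assume that $(M,* )$ is nontrivial. Then the following are equivalent: (i) there exists an $R$-linear good involution of $(M,* )$; (ii) $(M,* )$ is a kei; (iii) the characteristic of $R$ is $2$.
   Context: A quandle is a set $X$ with a binary operation $*$ such that $x*x=x$ for all $x$; for all $x,y\in X$ there is a unique $z\in X$ with $z*y=x$; and $(x*y)*z=(x*z)*(y*z)$ for all $x,y,z$. The dual operation $*^{-1}$ is defined by $(x*y)*^{-1}y=x$ and $(x*^{-1}y)*y=x$. A quandle is a kei if $x*y=x*^{-1}y$ for all $x,y\in X$. A quandle is trivial if $x*y=x$ for all $x,y$. An involution of $X$ is a map $\rho:X\to X$ with $\rho\circ\rho=\mathrm{id}_X$ (the identity is allowed). A good involution of $(X,* )$ is an involution $\rho$ such that (1) $\rho(x*y)=\rho(x)*y$ and (2) $x*\rho(y)=x*^{-1}y$ for all $x,y\in X$. For a free module $M$ of finite rank over a commutative ring $R$ with identity, with an antisymmetric bilinear form satisfying $\langle x,x\rangle=0$ for all $x$, the symplectic quandle $(M,* )$ is given by $x*y=x+\langle x,y\rangle y$; its dual operation is $x*^{-1}y=x-\langle x,y\rangle y$. A symplectic quandle is nontrivial if it is not a trivial quandle. *)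

(* Defs.v *)
From HB Require Import structures.
From mathcomp Require Import all_boot all_order all_algebra.

Set Implicit Arguments.
Unset Strict Implicit.
Unset Printing Implicit Defensive.

Import GRing.Theory.
Local Open Scope ring_scope.

(* The laws [qopK] and [qdualK] determine [qdual] uniquely from [qop], so the
   dual operation is a component of the structure but not extra data. *)
Record quandle : Type := Quandle {
  quandle_sort :> Type;
  qop : quandle_sort -> quandle_sort -> quandle_sort;
  qdual : quandle_sort -> quandle_sort -> quandle_sort;
  qop_idem : forall x, qop x x = x;
  qop_div : forall x y, exists! z, qop z y = x;
  qop_distr : forall x y z, qop (qop x y) z = qop (qop x z) (qop y z);
  qopK : forall x y, qdual (qop x y) y = x;
  qdualK : forall x y, qop (qdual x y) y = x
}.

Definition is_kei (X : quandle) : Prop :=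
  forall x y : X, qop x y = qdual x y.

Definition is_trivial (X : quandle) : Prop :=
  forall x y : X, qop x y = x.

Definition good_involution (X : quandle) (rho : X -> X) : Prop :=
  [/\ involutive rho,
      forall x y : X, rho (qop x y) = qop (rho x) y
    & forall x y : X, qop x (rho y) = qdual x y].

Definition antisymmetric_form (R : pzRingType) (M : Type) (b : M -> M -> R) :
  Prop := forall x y, b x y = - b y x.

Definition alternating_form (R : pzRingType) (M : Type) (b : M -> M -> R) :
  Prop := forall x, b x x = 0.

Section SymplecticQuandle.

Variables (R : comNzRingType) (M : vectType R) (b : {biscalar M}).
Hypotheses (b_anti : antisymmetric_form b) (b_alt : alternating_form b).

Definition symp_op (x y : M) : M := x + b x y *: y.
Definition symp_dual (x y : M) : M := x - b x y *: y.

Lemma symp_op_idem x : symp_op x x = x.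
Proof. by rewrite /symp_op b_alt scale0r addr0. Qed.

Lemma symp_opK x y : symp_dual (symp_op x y) y = x.
Proof.
by rewrite /symp_dual /symp_op linearDl linearZl_LR /= b_alt mulr0 addr0 addrK.
Qed.

Lemma symp_dualK x y : symp_op (symp_dual x y) y = x.
Proof.
by rewrite /symp_dual /symp_op linearBl linearZl_LR /= b_alt mulr0 subr0 subrK.
Qed.

Lemma symp_op_div x y : exists! z, symp_op z y = x.
Proof.
exists (symp_dual x y); split; first exact: symp_dualK.
by move=> z <-; rewrite symp_opK.
Qed.

Lemma symp_op_distr x y z :
  symp_op (symp_op x y) z = symp_op (symp_op x z) (symp_op y z).
Proof.
rewrite -[RHS]/(symp_op x z + b (symp_op x z) (symp_op y z) *: symp_op y z).
have -> : b (symp_op x z) (symp_op y z) = b x y.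
  rewrite /symp_op linearDl !linearDr !linearZl_LR !linearZr_LR /=.
  rewrite b_alt (b_anti z y) !mulr0 addr0 mulrN.
  by rewrite [b y z * _]mulrC addrK.
rewrite /symp_op linearDl linearZl_LR /= scalerDl scalerDr scalerA.
by rewrite !addrA; congr (_ + _); rewrite addrAC.
Qed.

Definition symplectic_quandle : quandle :=
  Quandle symp_op_idem symp_op_div symp_op_distr symp_opK symp_dualK.

End SymplecticQuandle.

(* Main.v *)
Require Import Defs.
From HB Require Import structures.
From mathcomp Require Import all_boot all_order all_algebra.

Set Implicit Arguments.
Unset Strict Implicit.
Unset Printing Implicit Defensive.

Import GRing.Theory VectorInternalTheory.
Local Open Scope ring_scope.

(** The quandle is a kei exactly when all the vectors [b x y *: y] are killed
    by 2 ([symplectic_keiE]), and a free module over an integral domain has no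
    torsion ([domain_scaler_eq0]).

    Let [rho] be a linear good involution, and put [c = b x y], which may be
    taken nonzero, and [d = b (rho x) y].  Expanding the first axiom by linearity leaves
    [c *: rho y = d *: y]: the involution preserves the line of [y] up to
    scalars.  Applying [rho] gives [c *: y = d *: rho y], so [c ^ 2] and
    [d ^ 2] act in the same way on [y]; morally [rho y] is [y] or [- y].
    In both cases [b x (rho y) *: rho y = c *: y], while the second axiom says
    that it equals [- (c *: y)].  Hence [c *: y] is killed by 2.

    If the quandle is a kei and 2 is nonzero in [R], torsion-freeness forces
    [b x y *: y = 0] for all [x] and [y], so the quandle is trivial.  Finally,
    in characteristic 2 the identity is a linear good involution. *)

(** Coordinates embed [M] linearly into a power of [R], so torsion
    can be tested on each coordinate. *)
Lemma domain_scaler_eq0 (R : idomainType) (M : vectType R) (a : R) (v : M) :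
  (a *: v == 0) = (a == 0) || (v == 0).
Proof.
apply/idP/idP=> [/eqP av0|/orP[]/eqP->]; rewrite ?scale0r ?scaler0 //.
have [//|a_neq0 /=] := eqVneq a 0.
apply/eqP/v2r_inj; rewrite linear0.
apply/rowP=> i; rewrite mxE.
have : (v2r (a *: v)) 0 i = 0 by rewrite av0 linear0 mxE.
by rewrite linearZ mxE => /eqP; rewrite mulf_eq0 (negPf a_neq0) => /eqP.
Qed.

Lemma symplectic_keiE (R : comNzRingType) (M : vectType R) (b : {biscalar M})
    (b_anti : antisymmetric_form b) (b_alt : alternating_form b) :
  is_kei (symplectic_quandle b_anti b_alt) <->
  forall x y : M, 2%:R *: (b x y *: y) = 0.
Proof.
split=> [kei x y | tors x y].
  have /addrI e : x + b x y *: y = x - b x y *: y := kei x y.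
  by rewrite scaler_nat mulr2n {1}e addNr.
congr (_ + _); apply/eqP; rewrite -addr_eq0 -mulr2n -scaler_nat.
exact/eqP/tors.
Qed.

(** To avoid dividing by [c], the two axioms are compared after multiplying
    the second one by [c ^ 2]: each of the two occurrences of [rho y] in it
    absorbs one factor [c] and becomes [d *: y]. *)
Lemma linear_good_involution_kei (R : idomainType) (M : vectType R)
    (b : {biscalar M})
    (b_anti : antisymmetric_form b) (b_alt : alternating_form b)
    (rho : {linear M -> M}) :
  @good_involution (symplectic_quandle b_anti b_alt) rho ->
  is_kei (symplectic_quandle b_anti b_alt).
Proof.
move=> [rhoK rho_op op_rho]; apply/symplectic_keiE => x y.
set c := b x y; pose d := b (rho x) y.
have [->|c_neq0] := eqVneq c 0; first by rewrite scale0r scaler0.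
have line : c *: rho y = d *: y.
  have : rho (x + c *: y) = rho x + d *: y := rho_op x y.
  by rewrite linearD linearZ => /addrI.
have line' : c *: y = d *: rho y.
  by have := congr1 rho line; rewrite !linearZ /= rhoK.
have squares : (c * c) *: y = (d * d) *: y.
  by rewrite -scalerA line' scalerA mulrC -[LHS]scalerA line scalerA.
have neg : b x (rho y) *: rho y = - (c *: y).
  by have /addrI : x + b x (rho y) *: rho y = x - c *: y := op_rho x y.
have form : c * b x (rho y) = d * c.
  by rewrite -[LHS](linearZr_LR b x c) line linearZr_LR.
have pos : (c * c) *: (b x (rho y) *: rho y) = (c * c) *: (c *: y).
  rewrite -scalerA [c *: (b x (rho y) *: _)]scalerA form -scalerA line.
  by rewrite [d *: _]scalerA -squares !scalerA mulrA.
apply/eqP; rewrite scaler_nat mulr2n.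
have : (c * c) *: (c *: y + c *: y) == 0.
  by rewrite scalerDr -{1}pos neg scalerN addNr.
by rewrite domain_scaler_eq0 mulf_eq0 orbb (negPf c_neq0).
Qed.

Lemma nontrivial_kei_pchar2 (R : idomainType) (M : vectType R)
    (b : {biscalar M})
    (b_anti : antisymmetric_form b) (b_alt : alternating_form b) :
  ~ is_trivial (symplectic_quandle b_anti b_alt) ->
  is_kei (symplectic_quandle b_anti b_alt) -> 2%N \in [pchar R].
Proof.
move=> nontrivial /symplectic_keiE tors; rewrite inE /=.
apply/negPn/negP=> two_neq0; apply: nontrivial => x y.
have /eqP := tors x y; rewrite domain_scaler_eq0 (negPf two_neq0) /= => /eqP e.
by rewrite /= /symp_op e addr0.
Qed.

Lemma pchar2_id_good_involution (R : comNzRingType) (M : vectType R)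
    (b : {biscalar M})
    (b_anti : antisymmetric_form b) (b_alt : alternating_form b) :
  2%N \in [pchar R] ->
  @good_involution (symplectic_quandle b_anti b_alt) idfun.
Proof.
move=> char2; split=> // x y.
by rewrite /= /symp_op /symp_dual -scaleNr (oppr_pchar2 char2).
Qed.

Theorem theorem1p3 (R : idomainType) (M : vectType R) (b : {biscalar M})
    (b_anti : antisymmetric_form b) (b_alt : alternating_form b)
    (nontrivial : ~ is_trivial (symplectic_quandle b_anti b_alt)) :
  [<-> exists rho : {linear M -> M},
         @good_involution (symplectic_quandle b_anti b_alt) rho;
       is_kei (symplectic_quandle b_anti b_alt);
       2%N \in [pchar R]].
Proof.
tfae.
- by case=> rho; apply: linear_good_involution_kei.
- exact: nontrivial_kei_pchar2.
- by move=> char2; exists idfun; apply: pchar2_id_good_involution.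
Qed.
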